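(* Let $(M_{k,l})_{k,l\ge 1}$ be the sequence defined by $M_{k,1} = M_{1,l} = 1$ for all $k,l \geq 1$, and, for $k,l\ge 2$, \[M_{k,l} = \left(M_{k,l-1}^{-1/\mu} + M_{k-1,l}^{-1/\mu}\right)^{-\mu}, \quad \text{where } \mu = \max(k, l).\] Then $c_t \geq M_{t,t}$ for every $t\ge 1$.
   Context: For a graph $G$, $k_t(G)$ denotes the number of complete subgraphs on $t$ vertices in $G$, and $\overline{G}$ is the complement of $G$. Let $k_t(n) = \min\{k_t(G) + k_t(\overline{G}) : |G| = n\}$, i.e. the minimum number of monochromatic copies of $K_t$ in a two-colouring of the edges of $K_n$. The Ramsey multiplicity constant is $c_t = \lim_{n\to\infty} k_t(n)/\binom{n}{t}$ (this limit exists since the ratios $k_t(n)/\binom{n}{t}$ are nondecreasing in $n$ and bounded by $1$). *)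

(* Defs.v *)
From HB Require Import structures.
From mathcomp Require Import all_boot all_order all_algebra.
From mathcomp Require Import all_classical all_reals all_analysis.

Set Implicit Arguments.
Unset Strict Implicit.
Unset Printing Implicit Defensive.

Import Order.TTheory GRing.Theory Num.Theory.
Import numFieldNormedType.Exports.

(* A simple graph on T is given by its set of edges, an edge being an         *)
(* unordered pair of distinct vertices.                                       *)
Record sgraph (T : finType) := SGraph {
  edges : {set {set T}};
  _ : edges \subset [set e : {set T} | #|e| == 2]
}.

HB.instance Definition _ (T : finType) := [isSub for @edges T].
HB.instance Definition _ (T : finType) := [Finite of sgraph T by <:].

Section Graphs.
Variable T : finType.

Definition empty_sgraph : sgraph T :=
  @SGraph T finset.set0 (finset.sub0set _).

Definition compl_sgraph (G : sgraph T) : sgraph T :=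
  @SGraph T ([set e : {set T} | #|e| == 2] :\: edges G) (finset.subsetDl _ _).

Definition adj (G : sgraph T) (x y : T) : bool := [set x; y]%SET \in edges G.

Definition clique (G : sgraph T) (A : {set T}) : bool :=
  [forall x in A, forall y in A, (x != y) ==> adj G x y].

Definition num_cliques (t : nat) (G : sgraph T) : nat :=
  #|[set A : {set T} | (#|A| == t) && clique G A]|.

Definition num_mono (t : nat) (G : sgraph T) : nat :=
  num_cliques t G + num_cliques t (compl_sgraph G).

End Graphs.

Definition min_mono (t n : nat) : nat :=
  num_mono t [arg min_(G < empty_sgraph 'I_n) num_mono t G].

Local Open Scope ring_scope.
Local Open Scope classical_set_scope.

(* For n < t the ratio is the conventional value _ / 0 = 0, which does not    *)
(* affect the limit.                                                          *)
Definition ramsey_mult (R : realType) (t : nat) : R :=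
  lim (((min_mono t n)%:R / 'C(n, t)%:R : R) @[n --> \oo]).

(* The values at k = 0 or l = 0 are junk.                                     *)
Fixpoint Mseq (R : realType) (k : nat) {struct k} : nat -> R :=
  fix Mk (l : nat) {struct l} : R :=
    match k, l with
    | k'.+1, l'.+1 =>
        if (k == 1%N) || (l == 1%N) then 1 else
        let mu : R := (maxn k l)%:R in
        (Mk l' `^ (- 1 / mu) + Mseq R k' l `^ (- 1 / mu)) `^ (- mu)
    | _, _ => 1
    end.

Lemma MseqS1 (R : realType) (k : nat) : (1 <= k)%N -> Mseq R k 1 = 1.
Proof. by case: k => [|[|k]]. Qed.

Lemma Mseq1S (R : realType) (l : nat) : (1 <= l)%N -> Mseq R 1 l = 1.
Proof. by case: l. Qed.

Lemma MseqE (R : realType) (k l : nat) : (2 <= k)%N -> (2 <= l)%N ->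
  let mu : R := (maxn k l)%:R in
  Mseq R k l =
    (Mseq R k l.-1 `^ (- 1 / mu) + Mseq R k.-1 l `^ (- 1 / mu)) `^ (- mu).
Proof. by case: k => [|[|k]] //; case: l => [|[|l]]. Qed.

(* Main.v *)
Require Import Defs.
From HB Require Import structures.
From mathcomp Require Import all_boot all_order all_algebra.
From mathcomp Require Import all_classical all_reals all_analysis.
From mathcomp Require Import lra zify.

(* Colour the edges of K_n red (G) and blue (its complement), and count tuples
   in which any two entries are equal or joined in the given colour.  Allowing
   repetitions makes the red and the blue neighbourhood of a vertex both contain
   that vertex, so the Erdos-Szekeres recursion holds for every vertex set A with
   no error term: A contains at least M_{k,l} |A|^k red k-tuples or at least
   M_{k,l} |A|^l blue l-tuples.  Indeed put p = (M_{k,l} / M_{k-1,l})^(1/mu) and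
   q = (M_{k,l} / M_{k,l-1})^(1/mu); the recursion says exactly p + q = 1.  Hence
   each vertex has red degree at least p |A| or blue degree at least q |A|, and
   either a proportion p of the vertices is of the first kind or a proportion q
   is of the second kind.  Repetitions contribute O(n^(k-1)) tuples, and the
   ratios min_mono t n / C(n, t) are nondecreasing (delete a vertex and average),
   so the limit exists and is at least each of them. *)

Set Implicit Arguments.
Unset Strict Implicit.
Unset Printing Implicit Defensive.

Import Order.TTheory GRing.Theory Num.Theory.

Local Open Scope ring_scope.

(** * Counting clique tuples with repetitions *)

Section Tuples.
Variables (T : finType) (e : rel T).

Definition cnbhd (v : T) : {set T} := [set u | (u == v) || e v u].

(* Counts the tuples of k elements of A, repetitions allowed, any two entries
   of which are equal or adjacent. *)
Fixpoint num_tuples (k : nat) (A : {set T}) : nat :=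
  if k is k'.+1 then (\sum_(v in A) num_tuples k' (A :&: cnbhd v))%N else 1%N.

Lemma num_tuples1 (A : {set T}) : num_tuples 1 A = #|A|.
Proof. by rewrite /= sum1_card. Qed.

Lemma num_tuplesS k (A : {set T}) :
  num_tuples k.+1 A = (\sum_(v in A) num_tuples k (A :&: cnbhd v))%N.
Proof. by []. Qed.

Lemma num_tuples_subset k (A B : {set T}) :
  A \subset B -> (num_tuples k A <= num_tuples k B)%N.
Proof.
elim: k A B => [//|k IH] A B sAB /=.
rewrite [leqRHS](big_setID A) /= (finset.setIidPr sAB); apply: leq_trans (leq_addr _ _).
by apply: leq_sum => v _; apply: IH; apply: finset.setSI.
Qed.

Lemma num_tuples_le k (A : {set T}) : (num_tuples k A <= #|T| ^ k)%N.
Proof.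
elim: k A => [//|k IH] A /=.
apply: (@leq_trans (\sum_(v in A) #|T| ^ k)%N); first exact: leq_sum.
by rewrite sum_nat_const expnS leq_mul2r max_card orbT.
Qed.

(** A new tuple has [v] in one of its [k] positions, and the other entries can be chosen in at most
    [#|T| ^ k.-1] ways. *)
Lemma num_tuples_setU1 k v (A : {set T}) :
  (num_tuples k (v |: A) <= num_tuples k A + k * #|T| ^ k.-1)%N.
Proof.
elim: k A => [//|k IH] A; case: (boolP (v \in A)) => vA.
  by rewrite (finset.setUidPr _) ?finset.sub1set // leq_addr.
rewrite 2!num_tuplesS big_setU1 //= mulSn addnCA; apply: leq_add.
  exact: num_tuples_le.
apply: (@leq_trans (\sum_(u in A) (num_tuples k (A :&: cnbhd u) + k * #|T| ^ k.-1))%N).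
  apply: leq_sum => u _; apply: leq_trans (IH _); apply: num_tuples_subset.
  by rewrite finset.setIUl finset.setSU // finset.subsetIl.
rewrite big_split /= leq_add2l sum_nat_const.
case: k {IH} => [|k]; first by rewrite mul0n muln0.
by rewrite mulnCA leq_mul2l expnS leq_mul2r max_card !orbT.
Qed.

End Tuples.

(** * From tuples to cliques *)

Section Cliques.
Variables (T : finType) (G : sgraph T).

Lemma adj_sym : symmetric (adj G).
Proof. by move=> x y; rewrite /adj finset.setUC. Qed.

Lemma adj_irrefl : irreflexive (adj G).
Proof.
move=> x; apply/negP; rewrite /adj finset.setUid => xG.
have /fintype.subsetP/(_ _ xG) := valP G.
by rewrite inE cards1.
Qed.

Lemma cliqueP (A : {set T}) :
  reflect {in A &, forall x y, x != y -> adj G x y} (clique G A).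
Proof.
apply: (iffP forall_inP) => [h x y xA yA xy|h x xA].
  by have /forall_inP/(_ _ yA)/implyP := h x xA; apply.
by apply/forall_inP => y yA; apply/implyP; apply: h.
Qed.

Lemma adj_compl x y : x != y -> adj (compl_sgraph G) x y = ~~ adj G x y.
Proof. by move=> xy; rewrite /adj !inE cards2 xy andbT. Qed.

Definition cliques_in (k : nat) (A : {set T}) : {set {set T}} :=
  [set S : {set T} | [&& S \subset A, #|S| == k & clique G S]].

Lemma card_cliques_inT k : #|cliques_in k [set: T]| = num_cliques k G.
Proof. by apply: eq_card => S; rewrite !inE finset.subsetT. Qed.

(** Double counting: adding [v] maps the [k]-cliques in its open neighbourhood injectively to
    [k.+1]-cliques through [v], and each of these is reached from at most its [k.+1] vertices. *)
Lemma sum_cliques_nbhd k (A : {set T}) :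
  (\sum_(v in A) #|cliques_in k (A :&: [set u | adj G v u])|
     <= k.+1 * #|cliques_in k.+1 A|)%N.
Proof.
pose X v := [set S in cliques_in k.+1 A | v \in S].
apply: (@leq_trans (\sum_(v in A) #|X v|)%N).
  apply: leq_sum => v vA.
  have vS (S : {set T}) : S \in cliques_in k (A :&: [set u | adj G v u]) -> v \notin S.
    rewrite !inE => /and3P[/fintype.subsetP sS _ _]; apply/negP => /sS.
    by rewrite !inE adj_irrefl andbF.
  rewrite -(card_in_imset (f := fun S => v |: S)); last first.
    by move=> S1 S2 /vS v1 /vS v2 eS; rewrite -(setU1K v1) eS setU1K.
  apply/subset_leq_card/fintype.subsetP => _ /imsetP[S SX ->].
  have vnS := vS _ SX; move: SX; rewrite !inE => /and3P[sS cS /cliqueP clS].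
  rewrite eqxx /= andbT cardsU1 vnS add1n eqSS cS /=.
  have /andP[sA /fintype.subsetP sN] : (S \subset A) && (S \subset [set u | adj G v u]).
    by rewrite -finset.subsetI.
  apply/andP; split; first by rewrite finset.subUset finset.sub1set vA.
  apply/cliqueP => x y; rewrite !inE => /orP[/eqP->|xS] /orP[/eqP->|yS] xy.
  - by rewrite eqxx in xy.
  - by have := sN _ yS; rewrite inE.
  - by have := sN _ xS; rewrite inE adj_sym.
  - exact: clS.
under eq_bigr do rewrite -sum1_card.
rewrite (exchange_big_dep (mem (cliques_in k.+1 A))) /=; last first.
  by move=> v S _; rewrite inE => /andP[].
rewrite mulnC -sum_nat_const; apply: leq_sum => S.
rewrite sum1dep_card; move=> SX; have /[!inE] /and3P[_ /eqP <- _] := SX.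
by apply/subset_leq_card/fintype.subsetP => v; rewrite !inE => /and3P[].
Qed.

(** A [k]-clique has [k]! orderings; the error term bounds the tuples with a repetition. In the
    induction, passing from the closed to the open neighbourhood costs [k * #|T| ^ k.-1] per vertex,
    and k^2 + k <= (k+1)^2. *)
Lemma num_tuples_cliques k (A : {set T}) :
  (num_tuples (adj G) k A <= k`! * #|cliques_in k A| + k ^ 2 * #|T| ^ k.-1)%N.
Proof.
elim: k A => [|k IH] A.
  rewrite /= addn0 mul1n card_gt0; apply/set0Pn; exists finset.set0.
  rewrite !inE finset.sub0set cards0 eqxx /=; apply/cliqueP => x y.
  by rewrite inE.
rewrite num_tuplesS.
pose err := (k ^ 2 * #|T| ^ k.-1 + k * #|T| ^ k.-1)%N.
pose N v := (A :&: [set u | adj G v u])%SET.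
apply: (@leq_trans (\sum_(v in A) (k`! * #|cliques_in k (N v)| + err))%N).
  apply: leq_sum => v vA; rewrite /err addnA.
  apply: leq_trans (leq_add (IH _) (leqnn _)).
  apply: leq_trans (num_tuples_setU1 _ _ v _); apply: num_tuples_subset.
  by apply/fintype.subsetP => u; rewrite !inE => /andP[-> ->].
rewrite big_split /= -big_distrr /= sum_nat_const; apply: leq_add.
  by rewrite factS [(k.+1 * _)%N]mulnC -mulnA leq_mul2l sum_cliques_nbhd orbT.
apply: leq_trans (leq_mul (max_card _) (leqnn _)) _; rewrite /err.
case: k {IH N err} => [|k]; first by rewrite !mul0n muln0.
rewrite !succnK; set N := #|T|; have -> : (N ^ k.+1 = N * N ^ k)%N by rewrite expnS.
set m := (N ^ k)%N; nia.
Qed.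

End Cliques.


(** * The recursion for [Mseq] as a pair of proportions *)

Section Recursion.
Variable R : realType.

Lemma Mseq_gt0 k l : 0 < Mseq R k l.
Proof.
elim: k l => [|k IHk]; first by case.
elim=> [//|l IHl] /=; case: ifP => // _.
by apply: powR_gt0; apply: addr_gt0; apply: powR_gt0.
Qed.

Lemma powR_rootK (x : R) n : 0 < x -> (0 < n)%N ->
  x `^ (- 1 / n%:R) ^+ n * x = 1.
Proof.
move=> x0 n0; rewrite -powR_mulrn ?powR_ge0 // -powRrM divfK; last first.
  by rewrite pnatr_eq0 -lt0n.
by rewrite powR_inv1 ?ltW // mulVf ?gt_eqF.
Qed.

Lemma Mseq_ratios k l : (1 <= k)%N -> (1 <= l)%N ->
  exists p q : R, [/\ 0 < p, 0 < q, p + q = 1,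
    p ^+ maxn k.+1 l.+1 * Mseq R k l.+1 = Mseq R k.+1 l.+1 &
    q ^+ maxn k.+1 l.+1 * Mseq R k.+1 l = Mseq R k.+1 l.+1].
Proof.
move=> k1 l1; have mu0 : (0 < maxn k.+1 l.+1)%N by rewrite leq_max.
rewrite (@MseqE R k.+1 l.+1) //=; set mu := maxn _ _ in mu0 *.
have := powR_rootK (Mseq_gt0 k l.+1) mu0.
have := powR_rootK (Mseq_gt0 k.+1 l) mu0.
have := powR_gt0 (- 1 / mu%:R) (Mseq_gt0 k l.+1).
have := powR_gt0 (- 1 / mu%:R) (Mseq_gt0 k.+1 l).
set x := _ `^ _; set y := _ `^ _; move=> x0 y0 xM yM.
have s0 : 0 < x + y by rewrite addr_gt0.
(* Here [x ^+ mu] and [y ^+ mu] are the inverses of M_{k+1,l} and M_{k,l+1}, and M_{k+1,l+1} is the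
   inverse of (x + y)^mu. *)
exists (y / (x + y)), (x / (x + y)).
rewrite !divr_gt0 // powR_invn ?ltW // !expr_div_n; split=> //.
- by rewrite -mulrDl [y + x]addrC divff ?gt_eqF.
- by rewrite mulrAC yM mul1r.
- by rewrite mulrAC xM mul1r.
Qed.

End Recursion.

(** * The Ramsey-type induction on tuples *)

Section Step.
Variables (R : realType) (T : finType).

(* Each v in D either forces many f-tuples inside its e-neighbourhood or lies
   in at least p^k M' |A|^k of the e-tuples; since k < mu the latter exceeds
   M |A|^k by a factor 1/p, which pays for D being only a fraction p of A. *)
Lemma num_tuples_step (e f : rel T) (k l mu : nat) (p M M' : R) (A D : {set T}) :
    0 <= p <= 1 -> 0 <= M' -> p ^+ mu * M' = M -> (k < mu)%N -> (l <= mu)%N ->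
    (forall B : {set T}, M' * #|B|%:R ^+ k <= (num_tuples e k B)%:R \/
                         M' * #|B|%:R ^+ l <= (num_tuples f l B)%:R) ->
    D \subset A -> {in D, forall v, p * #|A|%:R <= #|A :&: cnbhd e v|%:R} ->
    p * #|A|%:R <= #|D|%:R ->
  M * #|A|%:R ^+ k.+1 <= (num_tuples e k.+1 A)%:R \/
  M * #|A|%:R ^+ l <= (num_tuples f l A)%:R.
Proof.
move=> /andP[p0 p1] M'0 <- kmu lmu IH sDA Dnb cD.
have pA0 : 0 <= p * #|A|%:R by rewrite mulr_ge0.
have pow_le m : (m <= mu)%N -> p ^+ mu * M' * #|A|%:R ^+ m <= M' * (p * #|A|%:R) ^+ m.
  move=> mmu; rewrite exprMn mulrA [M' * _]mulrC.
  by rewrite ler_wpM2r ?exprn_ge0 // ler_wpM2r // ler_wiXn2l.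
have [hf|hf] := lerP (p ^+ mu * M' * #|A|%:R ^+ l) (num_tuples f l A)%:R.
  by right.
left; apply: le_trans (pow_le _ kmu) _.
have deg v : v \in D -> M' * (p * #|A|%:R) ^+ k <= (num_tuples e k (A :&: cnbhd e v))%:R.
  move=> vD; have [he|hf'] := IH (A :&: cnbhd e v).
    apply: le_trans he; rewrite ler_wpM2l // lerXn2r ?nnegrE //.
    exact: Dnb.
  (* Many [f]-tuples inside the neighbourhood of [v] would already be too many in [A], against
     [hf]. *)
  move: hf; rewrite ltNge => /negP[]; apply: le_trans (pow_le _ lmu) _.
  apply: le_trans (_ : M' * #|A :&: cnbhd e v|%:R ^+ l <= _).
    by rewrite ler_wpM2l // lerXn2r ?nnegrE //; apply: Dnb.
  by apply: le_trans hf' _; rewrite ler_nat num_tuples_subset // finset.subsetIl.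
apply: (@le_trans _ _ (\sum_(v in D) M' * (p * #|A|%:R) ^+ k)).
  rewrite sumr_const -[_ *+ #|D|]mulr_natr exprSr mulrA ler_wpM2l //.
  by rewrite mulr_ge0 ?exprn_ge0.
rewrite num_tuplesS natr_sum [leRHS](big_setID D) /= (finset.setIidPr sDA).
apply: ler_wpDr; first by rewrite sumr_ge0.
exact: ler_sum.
Qed.

Lemma num_tuples_ramsey (r b : rel T) k l (A : {set T}) :
    (forall x y, x != y -> r x y || b x y) -> (1 <= k)%N -> (1 <= l)%N ->
  Mseq R k l * #|A|%:R ^+ k <= (num_tuples r k A)%:R \/
  Mseq R k l * #|A|%:R ^+ l <= (num_tuples b l A)%:R.
Proof.
move=> rb; elim: k l A => [//|k IHk] l A _.
elim: l A => [//|l IHl] A _.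
have [->|k0] := posnP k.
  by left; rewrite Mseq1S // num_tuples1 expr1 mul1r.
have [->|l0] := posnP l.
  by right; rewrite MseqS1 // num_tuples1 expr1 mul1r.
have [p [q [p0 q0 pq pM qM]]] := Mseq_ratios R k0 l0.
(* For [u] = [v] both closed neighbourhoods contain [u], so nothing is lost even when [v] lies in
   [A]. *)
have cover v : (#|A| <= #|A :&: cnbhd r v| + #|A :&: cnbhd b v|)%N.
  apply: leq_trans (leq_card_setU _ _); apply/subset_leq_card/fintype.subsetP => u uA.
  rewrite !inE uA /=; case: eqVneq => //= uv.
  by apply: rb; rewrite eq_sym.
pose D := [set v in A | p * #|A|%:R <= (#|A :&: cnbhd r v|%:R : R)].
have sDA : D \subset A by apply/fintype.subsetP => v; rewrite inE => /andP[].
have cDA : #|A|%:R = #|D|%:R + #|A :\: D|%:R :> R.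
  by rewrite -(cardsID D A) (finset.setIidPr sDA) natrD.
have splitA : #|A|%:R = p * #|A|%:R + q * #|A|%:R :> R.
  by rewrite -mulrDl pq mul1r.
have [cD|cD] := lerP (p * #|A|%:R) (#|D|%:R : R).
  apply: (num_tuples_step (p := p) (D := D) _ _ pM) => //.
  - by rewrite ltW //= -pq lerDl ltW.
  - exact/ltW/Mseq_gt0.
  - by rewrite leq_maxl.
  - by rewrite leq_maxr.
  - by move=> B; apply: IHk.
  - by move=> v; rewrite inE => /andP[].
(* Now more than [q * #|A|] vertices have red degree below [p * #|A|], hence blue degree above
   [q * #|A|]: the same step applies with the colours exchanged. *)
suff : Mseq R k.+1 l.+1 * #|A|%:R ^+ l.+1 <= (num_tuples b l.+1 A)%:R \/
       Mseq R k.+1 l.+1 * #|A|%:R ^+ k.+1 <= (num_tuples r k.+1 A)%:R.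
  by case; [right|left].
apply: (num_tuples_step (p := q) (D := A :\: D) _ _ qM) => //.
- by rewrite ltW //= -pq lerDr ltW.
- exact/ltW/Mseq_gt0.
- by rewrite leq_maxr.
- by rewrite leq_maxl.
- by move=> B; case: (IHl B l0); [right|left].
- exact: finset.subsetDl.
- move=> v; rewrite !inE => /andP[nD vA]; move: nD; rewrite vA /= -ltNge => nD.
  have := cover v; rewrite -(ler_nat R) natrD; lra.
- lra.
Qed.

End Step.


(** * Elementary bounds on [min_mono] *)

Lemma min_mono_le t n (G : sgraph 'I_n) : (min_mono t n <= num_mono t G)%N.
Proof. by rewrite /min_mono; case: arg_minnP => // G0 _; apply. Qed.

Lemma min_mono_attained t n : exists G : sgraph 'I_n, min_mono t n = num_mono t G.
Proof. by eexists. Qed.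

Lemma num_cliques_le (T : finType) t (G : sgraph T) :
  (num_cliques t G <= 'C(#|T|, t))%N.
Proof.
rewrite -[#|T|](cardsT T) -cards_draws; apply/subset_leq_card/fintype.subsetP => S.
by rewrite !inE => /andP[-> _]; rewrite finset.subsetT.
Qed.

Lemma min_mono_le_bin t n : (min_mono t n <= 2 * 'C(n, t))%N.
Proof.
apply: leq_trans (min_mono_le t (empty_sgraph _)) _.
rewrite mul2n -addnn; apply: leq_add.
  by have := num_cliques_le t (empty_sgraph 'I_n); rewrite card_ord.
by have := num_cliques_le t (compl_sgraph (empty_sgraph 'I_n)); rewrite card_ord.
Qed.

(** * Vertex deletion and averaging *)

Section Deletion.
Variables (T U : finType) (f : U -> T).
Hypothesis f_inj : injective f.

Lemma preim_sgraph_subproof (G : sgraph T) :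
  [set e : {set U} | f @: e \in edges G] \subset [set e : {set U} | #|e| == 2].
Proof.
apply/fintype.subsetP => e; rewrite !inE => eG.
have /fintype.subsetP/(_ _ eG) := valP G.
by rewrite inE card_imset.
Qed.

Definition preim_sgraph (G : sgraph T) : sgraph U := SGraph (preim_sgraph_subproof G).

Lemma preim_sgraph_adj G x y : adj (preim_sgraph G) x y = adj G (f x) (f y).
Proof. by rewrite /adj inE finset.imsetU !finset.imset_set1. Qed.

Lemma preim_compl_sgraph G :
  preim_sgraph (compl_sgraph G) = compl_sgraph (preim_sgraph G).
Proof.
apply: val_inj; apply/setP => e /=.
by rewrite !inE card_imset.
Qed.

Lemma num_cliques_preim t G :
  num_cliques t (preim_sgraph G) =
  #|[set A : {set T} | [&& #|A| == t, clique G A & A \subset codom f]]|.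
Proof.
rewrite /num_cliques -(card_imset _ (imset_inj f_inj)); apply: eq_card => A.
apply/imsetP/idP => [[S]|].
  rewrite !inE => /andP[cS /cliqueP clS] ->; rewrite card_imset // cS /=.
  apply/andP; split; last first.
    by apply/fintype.subsetP => _ /finset.imsetP[x _ ->]; apply: codom_f.
  apply/cliqueP => _ _ /finset.imsetP[x xS ->] /finset.imsetP[y yS ->] xy.
  by rewrite -preim_sgraph_adj; apply: clS => //; apply: contraNneq xy => ->.
rewrite inE => /and3P[cA /cliqueP clA /fintype.subsetP sA].
have eA : A = f @: (f @^-1: A).
  apply/setP => x; apply/idP/finset.imsetP => [xA|[y yA ->]]; last first.
    by rewrite inE in yA.
  by have /codomP[y xy] := sA _ xA; exists y; rewrite // inE -xy.
exists (f @^-1: A)%SET => //; rewrite inE -(card_imset _ f_inj) -eA cA /=.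
apply/cliqueP => x y; rewrite !inE => xA yA xy.
by rewrite preim_sgraph_adj; apply: clA => //; rewrite (inj_eq f_inj).
Qed.

End Deletion.

Definition del_vertex n (G : sgraph 'I_n.+1) (v : 'I_n.+1) : sgraph 'I_n :=
  preim_sgraph (@lift_inj _ v) G.

(** A [t]-clique survives the deletion of exactly the [n.+1 - t] vertices outside it. *)
Lemma sum_num_cliques_del t n (G : sgraph 'I_n.+1) :
  (\sum_v num_cliques t (del_vertex G v) = (n.+1 - t) * num_cliques t G)%N.
Proof.
pose X := [set A : {set 'I_n.+1} | (#|A| == t) && clique G A].
have cX v : num_cliques t (del_vertex G v) = #|[set A in X | v \notin A]|.
  rewrite num_cliques_preim; apply: eq_card => A; rewrite !inE -andbA.
  congr [&& _, _ & _]; apply/fintype.subsetP/idP => [h|vA x xA].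
    by apply/negP => /h/codomP[y /eqP]; apply/negP/neq_lift.
  have /unlift_some[y -> _] : v != x by apply: contraNneq vA => ->.
  exact: codom_f.
under eq_bigr do rewrite cX -sum1_card.
rewrite (exchange_big_dep (mem X)) /=; last by move=> v A _; rewrite inE => /andP[].
rewrite mulnC -sum_nat_const; apply: eq_bigr => A AX; rewrite sum1dep_card.
have /[!inE] /andP[/eqP <- _] := AX.
rewrite -[X in (X - _)%N](card_ord n.+1) -(cardsC A) addKn.
by apply: eq_card => v; move: AX; rewrite !inE => ->.
Qed.

(** Delete each vertex in turn from an optimal colouring on [n.+1] vertices; deletion commutes with
    complement. *)
Lemma min_monoS t n :
  (n.+1 * min_mono t n <= (n.+1 - t) * min_mono t n.+1)%N.
Proof.
have [G ->] := min_mono_attained t n.+1.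
rewrite /num_mono mulnDr -!sum_num_cliques_del -big_split /=.
rewrite -{1}(card_ord n.+1) -sum_nat_const; apply: leq_sum => v _.
by rewrite /del_vertex preim_compl_sgraph; apply: min_mono_le.
Qed.

Lemma min_mono_ge (R : realType) t n : (1 <= t)%N ->
  Mseq R t t * n%:R ^+ t <= (t`! * min_mono t n + t ^ 2 * n ^ t.-1)%:R.
Proof.
move=> t1; have [G ->] := min_mono_attained t n.
have := num_tuples_ramsey R [set: 'I_n] (r := adj G) (b := adj (compl_sgraph G)) _ t1 t1.
rewrite cardsT card_ord => h.
have {h} [|h|h] := h; first by move=> x y xy; rewrite adj_compl // orbN.
all: apply: le_trans h _; rewrite ler_nat.
all: apply: leq_trans (num_tuples_cliques _ _ _) _.
all: by rewrite card_cliques_inT card_ord leq_add2r leq_mul2l /num_mono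
                ?leq_addr ?leq_addl orbT.
Qed.

(** * Monotone convergence of the ratios *)

Section Limit.
Variables (R : realType) (t : nat).

Let u (n : nat) : R := (min_mono t n)%:R / 'C(n, t)%:R.

Lemma min_mono_ratio_nondecreasing : nondecreasing_seq u.
Proof.
apply/nondecreasing_seqP => n; rewrite /u.
have [nt|tn] := ltnP n t; first by rewrite (bin_small nt) invr0 mulr0 divr_ge0.
have c0 : (0 : R) < 'C(n, t)%:R by rewrite ltr0n bin_gt0.
have c1 : (0 : R) < 'C(n.+1, t)%:R by rewrite ltr0n bin_gt0 leqW.
rewrite ler_pdivrMr // mulrAC ler_pdivlMr // -!natrM ler_nat.
have := min_monoS t n; have := mul_bin_down n.+1 t; rewrite /= => eC le.
have nt0 : (0 < n.+1 - t)%N by rewrite subn_gt0 ltnS.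
(* Scaling by [n.+1 - t] lets (n+1) C(n,t) = (n+1-t) C(n+1,t) turn the goal into the averaging
   inequality. *)
rewrite -(leq_pmul2l nt0) mulnCA -eC mulnCA !mulnA leq_mul2r.
by rewrite le orbT.
Qed.

Lemma min_mono_ratio_ubound : has_ubound (range u).
Proof.
(* The bound is 2, not 1: for [t] <= 1 every [t]-set is a clique in both colours. *)
exists 2 => _ [n _ <-]; rewrite /u.
have [nt|tn] := ltnP n t; first by rewrite (bin_small nt) invr0 mulr0.
by rewrite ler_pdivrMr ?ltr0n ?bin_gt0 // -natrM ler_nat min_mono_le_bin.
Qed.

Lemma min_mono_ratio_ge n : (1 <= t)%N -> (t <= n)%N ->
  Mseq R t t - (t ^ 2)%:R / n%:R <= u n.
Proof.
move=> t1 tn; have n0 : (0 : R) < n%:R by rewrite ltr0n (leq_trans t1).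
(* Replacing t! C(n,t) by the larger n^t is legitimate only when the factor in front is nonnegative;
   otherwise the claim is trivial. *)
have [neg|pos] := lerP (Mseq R t t) ((t ^ 2)%:R / n%:R).
  by rewrite (@le_trans _ _ 0) ?subr_le0 // divr_ge0.
have c0 : (0 : R) < 'C(n, t)%:R by rewrite ltr0n bin_gt0.
rewrite ler_pdivlMr // -(ler_pM2l (_ : 0 < t`!%:R)) ?ltr0n ?fact_gt0 //.
rewrite mulrCA -!natrM [(t`! * 'C(_, _))%N]mulnC bin_ffact.
apply: (@le_trans _ _ ((Mseq R t t - (t ^ 2)%:R / n%:R) * n%:R ^+ t)).
  rewrite ler_wpM2l ?subr_ge0 ?(ltW pos) // -natrX ler_nat.
  have -> : (n ^ t = \prod_(i < t) n)%N by rewrite prod_nat_const card_ord.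
  by rewrite ffact_prod; apply: leq_prod => i _; rewrite leq_subr.
rewrite mulrBl lerBlDr.
suff -> : (t ^ 2)%:R / n%:R * n%:R ^+ t = (t ^ 2 * n ^ t.-1)%:R :> R.
  by rewrite -natrD min_mono_ge.
have -> : n%:R ^+ t = n%:R * n%:R ^+ t.-1 :> R by rewrite -exprS prednK.
by rewrite mulrA divfK ?gt_eqF // natrM [(n ^ _)%:R]natrX.
Qed.

End Limit.

Theorem theorem4 (R : realType) (t : nat) (ht : (1 <= t)%N) :
  Mseq R t t <= ramsey_mult R t.
Proof.
have nd := @min_mono_ratio_nondecreasing R t.
have cv := nondecreasing_is_cvgn nd (@min_mono_ratio_ubound R t).
apply/ler_addgt0Pr => eps eps0; rewrite -lerBlDr.
(* Large enough that the error t^2 / n is at most [eps]. *)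
pose n := maxn t (Num.bound ((t ^ 2)%:R / eps)).
have tn : (t <= n)%N by rewrite leq_maxl.
apply: le_trans (nondecreasing_cvgn_le nd cv n).
apply: le_trans (min_mono_ratio_ge R ht tn); rewrite lerD2l lerN2.
have n0 : (0 : R) < n%:R by rewrite ltr0n (leq_trans ht).
rewrite ler_pdivrMr // mulrC -ler_pdivrMr //.
apply: le_trans (ltW (archi_boundP _)) _; first by rewrite divr_ge0 // ltW.
by rewrite ler_nat leq_maxr.
Qed.
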